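(* For any integers $k\ge 1$ and $n\ge 3$ there exists a (minimal) positive integer $C_k(n)$ such that the following holds: every $k$-crossing system of paths $S$ of size at least $C_k(n)$ contains a subsystem of size $n$ which is upper convex or lower convex.
   Context: A path is the graph of a continuous function $f:[0,1]\to\mathbb{R}$. A system of paths is a finite collection of at least three paths such that: the paths have distinct endpoints (the left endpoints are pairwise distinct and the right endpoints are pairwise distinct); any two paths intersect in finitely many points; no two paths are tangent, i.e. paths cross at every point where they intersect; no three paths have a common point. A system is $k$-crossing if each pair of its paths crosses at least $1$ time and at most $k$ times. The size of a system is its number of paths; a subsystem is a subset of at least three of its paths. A path belongs to the upper (lower) envelope of a system if for some $t\in[0,1]$ it lies strictly above (below) every other path of the system at $t$. A system is upper (lower) convex if all of its paths belong to its upper (lower) envelope. *)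

(* Defs.v *)
From mathcomp Require Import all_boot all_order all_algebra.
From mathcomp Require Import all_classical all_reals all_analysis.
Import Order.TTheory GRing.Theory Num.Theory.
Import numFieldNormedType.Exports.

Set Implicit Arguments.
Unset Strict Implicit.
Unset Printing Implicit Defensive.

Local Open Scope classical_set_scope.
Local Open Scope ring_scope.

(* A path is represented by a total function R -> R; only its values on
   [0, 1] are ever constrained or used. *)
Definition is_path (R : realType) (f : R -> R) : Prop :=
  {within `[0, 1], continuous f}.

Definition intersection_points (R : realType) (f g : R -> R) : set R :=
  [set t | t \in `[0, 1] /\ f t = g t].

(* The open interval keeps the one-sided neighbourhoods of t inside [0, 1];
   paths with distinct endpoints never meet at 0 or 1. *)
Definition crosses_at (R : realType) (f g : R -> R) (t : R) : Prop :=
  [/\ t \in `]0, 1[, f t = g t &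
      ((\forall s \near t^'-, f s < g s) /\ (\forall s \near t^'+, g s < f s))
   \/ ((\forall s \near t^'-, g s < f s) /\ (\forall s \near t^'+, f s < g s))].

Definition crossing_points (R : realType) (f g : R -> R) : set R :=
  [set t | crosses_at f g t].

(* A finite collection of paths is a family indexed by a finite type; distinct
   indices carry distinct paths because their endpoints differ. *)
Record path_system (R : realType) (I : finType) (f : I -> R -> R) : Prop := {
  system_size : (3 <= #|I|)%N ;
  system_path : forall i, is_path (f i) ;
  system_left_endpoints : forall i j, i != j -> f i 0 != f j 0 ;
  system_right_endpoints : forall i j, i != j -> f i 1 != f j 1 ;
  system_finite_intersections :
    forall i j, i != j -> finite_set (intersection_points (f i) (f j)) ;
  system_not_tangent : forall i j, i != j ->
    forall t, intersection_points (f i) (f j) t -> crosses_at (f i) (f j) t ;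
  system_no_triple_point : forall i j l, i != j -> j != l -> i != l ->
    forall t, t \in `[0, 1] -> ~ (f i t = f j t /\ f j t = f l t)
}.

Definition crossing_system (R : realType) (k : nat) (I : finType)
    (f : I -> R -> R) : Prop :=
  path_system f /\
  forall i j, i != j ->
    crossing_points (f i) (f j) !=set0 /\ (crossing_points (f i) (f j) #<= `I_k)%card.

Definition subsystem (R : realType) (I : finType) (f : I -> R -> R)
    (A : {set I}) : {i : I | i \in A} -> R -> R :=
  fun i => f (val i).

Definition in_upper_envelope (R : realType) (I : finType) (f : I -> R -> R)
    (i : I) : Prop :=
  exists2 t : R, t \in `[0, 1] & forall j, j != i -> f j t < f i t.

Definition in_lower_envelope (R : realType) (I : finType) (f : I -> R -> R)
    (i : I) : Prop :=
  exists2 t : R, t \in `[0, 1] & forall j, j != i -> f i t < f j t.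

Definition upper_convex (R : realType) (I : finType) (f : I -> R -> R) : Prop :=
  forall i, in_upper_envelope f i.

Definition lower_convex (R : realType) (I : finType) (f : I -> R -> R) : Prop :=
  forall i, in_lower_envelope f i.

Definition convex_subsystem_bound (R : realType) (k n C : nat) : Prop :=
  forall (I : finType) (f : I -> R -> R),
    crossing_system k f -> (C <= #|I|)%N ->
    exists A : {set I}, #|A| = n /\
      (upper_convex (@subsystem R I f A) \/ lower_convex (@subsystem R I f A)).

(* Main.v *)
Require Import Defs.
From mathcomp Require Import all_boot all_order all_algebra.
From mathcomp Require Import all_classical all_reals all_analysis.
From mathcomp Require Import zify.
Import Order.TTheory GRing.Theory Num.Theory.
Import numFieldNormedType.Exports.

Set Implicit Arguments.
Unset Strict Implicit.
Unset Printing Implicit Defensive.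

Local Open Scope classical_set_scope.
Local Open Scope ring_scope.

(** Order the paths by their left endpoints and let T(i,j) be the time of the
    first meeting of paths i < j, so that i is below j before T(i,j). For
    i < j < l record three bits: the position of j relative to i and l at T(i,l),
    of i relative to j and l at T(j,l), and of l relative to i and j at T(i,j).
    Ramsey's theorem for triples yields 2n+1 paths on which these bits are
    constant. Up to reflecting the picture upside down, j is below i and l at
    T(i,l) for all i < j < l. If moreover i is below j and l at T(j,l), then every
    j is on top of the others at T(j,last), the path "last" apart. Otherwise,
    with j' the successor of j, path j is at the bottom at T(j,j'), j' apart:
    j' is below j at T(j,l), so T(j,j') < T(j,l) for all l > j'. Keep every
    other path. *)

(** * Ramsey's theorem for subsequences of a fixed length *)

Definition homogeneous (T C : eqType) (r : nat) (chi : seq T -> C) (s : seq T)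
    (c : C) : Prop :=
  forall t, subseq t s -> size t = r -> chi t = c.

Lemma homogeneous_cons (T C : eqType) (r : nat) (chi : seq T -> C) (x : T)
    (s : seq T) (c : C) :
  homogeneous r (fun t => chi (x :: t)) s c -> homogeneous r.+1 chi s c ->
  homogeneous r.+1 chi (x :: s) c.
Proof.
move=> hx hs [|y t] //=; case: eqP => [->|_] sub_t size_t.
  by apply: hx => //; case: size_t.
exact: hs.
Qed.

Lemma homogeneous_subseq (T C : eqType) (r : nat) (chi : seq T -> C)
    (s s' : seq T) (c : C) :
  subseq s' s -> homogeneous r chi s c -> homogeneous r chi s' c.
Proof. by move=> ss' hs t ts'; apply: hs; exact: subseq_trans ts' ss'. Qed.

(** Separate targets [N c] allow an inner induction on their sum. The tail is coloured by
    [chi (x :: _)] at rank [r]; inside a homogeneous part of colour [c] the target of [c] may be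
    lowered by one, since [x] can be put in front if [c] comes out again. *)
Lemma ramsey (C : finType) (r : nat) (N : C -> nat) : exists M : nat,
  forall (T : eqType) (chi : seq T -> C) (s : seq T), (M <= size s)%N ->
  exists c s', [/\ subseq s' s, size s' = N c & homogeneous r chi s' c].
Proof.
elim: r N => [|r IHr] N.
  exists (\max_c N c) => T chi s Ms.
  exists (chi [::]), (take (N (chi [::])) s); split; first exact: take_subseq.
    by apply: size_takel; apply: leq_trans Ms; exact: leq_bigmax.
  by move=> t _ /size0nil ->.
have [n] := ubnP (\sum_c N c); elim: n N => // n IHn N; rewrite ltnS => Nn.
have [[c0 Nc0]|N0] := pselect (exists c, N c = 0%N).
  exists 0%N => T chi s _; exists c0, [::]; rewrite Nc0; split => //.
    exact: sub0seq.
  by move=> t /size_subseq /= + e; rewrite e.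
pose dec c d := if d == c then (N d).-1 else N d.
have Ngt0 c : (0 < N c)%N by rewrite lt0n; apply/eqP => ?; apply: N0; exists c.
have /choice[M HM] : forall c, exists M : nat,
    forall (T : eqType) (chi : seq T -> C) (s : seq T), (M <= size s)%N ->
    exists d s', [/\ subseq s' s, size s' = dec c d & homogeneous r.+1 chi s' d].
  move=> c; apply: IHn; apply: leq_trans Nn.
  rewrite (bigD1 c) //= [ltnRHS](bigD1 c) //= /dec eqxx.
  rewrite (eq_bigr N) => [|d /negbTE -> //].
  by have := Ngt0 c; lia.
(* The bounds [M c] become the targets at rank [r], so that a part of colour [c] is long enough for
   [HM c]. *)
have [M' HM'] := IHr M.
exists M'.+1 => T chi [//|x s] /= Ms.
have [c [s1 [ss1 size1 hom1]]] := HM' T (fun t => chi (x :: t)) s Ms.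
have [d [s2 [ss2 size2 hom2]]] := HM c T chi s1 ltac:(by rewrite size1).
have sub2 : subseq s2 s := subseq_trans ss2 ss1.
move: size2; rewrite /dec; case: eqP => [dc|_] size2; last first.
  by exists d, s2; split => //; apply: subseq_trans sub2 (subseq_cons _ _).
exists d, (x :: s2); split; first by rewrite /= eqxx.
  by rewrite /= size2 prednK.
apply: homogeneous_cons hom2; rewrite dc.
exact: homogeneous_subseq ss2 hom1.
Qed.

Lemma sorted_subset_subseq (T : eqType) (lt : rel T) (s t : seq T) :
  irreflexive lt -> transitive lt -> sorted lt s -> sorted lt t ->
  {subset t <= s} -> subseq t s.
Proof.
move=> irr tr ss st ts; suff -> : t = [seq x <- s | x \in t].
  exact: filter_subseq.
apply: (irr_sorted_eq tr irr) => //; first exact: sorted_filter.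
move=> x; rewrite mem_filter.
by case: (boolP (x \in t)) => // /ts ->.
Qed.

(** * First meeting of two paths *)

Section Meeting.
Context (R : realType).
Implicit Types f g : R -> R.

Lemma finite_set_min (A : set R) : finite_set A -> A !=set0 ->
  exists2 x, A x & forall y, A y -> x <= y.
Proof.
move=> /finite_seqP[s ->] [x xs].
case E : (sort <=%R s) => [|y s'].
  by have := mem_sort <=%R s x; rewrite E in_nil [x \in s]xs.
exists y; first by rewrite /= -(mem_sort <=%R) E mem_head.
move=> z; rewrite /= -(mem_sort <=%R) E inE => /predU1P[->//|zs'].
have : sorted <=%R (y :: s') by rewrite -E sort_le_sorted.
by move=> /(order_path_min le_trans) /allP; apply.
Qed.

Lemma lt_before_meeting f g (u : R) : is_path f -> is_path g ->
  u \in `[0, 1] -> f 0 < g 0 -> (forall v, v \in `[0, u] -> f v != g v) ->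
  f u < g u.
Proof.
rewrite in_itv /= => cf cg /andP[u0 u1] fg0 fg.
rewrite ltNge; apply/negP => gfu.
have sub : `[0, u] `<=` `[0, 1 : R].
  by apply: subset_itvl; rewrite bnd_simp.
have cgf : {within `[0, u], continuous (fun v => g v - f v)}.
  apply: (continuous_subspaceW sub) => v.
  by apply: continuousB; [exact: cg | exact: cf].
have [|v v0u /eqP] := @IVT _ (fun v => g v - f v) 0 u 0 u0 cgf.
  by rewrite ge_min le_max subr_ge0 (ltW fg0) [g u - _ <= _]subr_le0 gfu orbT.
by rewrite subr_eq0 eq_sym => /eqP e; have := fg v v0u; rewrite e eqxx.
Qed.

(** By the intermediate value theorem, the order at 0 persists until the least of the finitely many
    intersection points. *)
Lemma first_meeting f g : is_path f -> is_path g -> f 0 < g 0 ->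
  finite_set (intersection_points f g) -> intersection_points f g !=set0 ->
  exists t, [/\ t \in `[0, 1], f t = g t &
    forall u, u \in `[0, 1] -> u < t -> f u < g u].
Proof.
move=> cf cg fg0 fin ne0.
have [t [t01 fgt] tmin] := finite_set_min fin ne0.
exists t; split => // u u01 ut; apply: lt_before_meeting => // v v0u.
apply/eqP => fgv; move: u01 v0u; rewrite !in_itv /= => /andP[u0 u1] /andP[v0 vu].
have vt : v < t := le_lt_trans vu ut.
suff : t <= v by rewrite leNgt vt.
by apply: tmin; split => //; rewrite in_itv /= v0 (le_trans vu).
Qed.

End Meeting.

(** * Envelopes of a homogeneous family *)

(* Two times suffice for path 2i: its first meeting with path 2n, where it is on
   top if [c], and otherwise its first meeting with the discarded path 2i+1,
   where it is at the bottom. *)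
Lemma homogeneous_envelope (R : realType) (n : nat) (F : nat -> R -> R)
    (T : nat -> nat -> R) (c : bool) :
  (forall i j, (i < j <= n.*2)%N -> [/\ T i j \in `[0, 1],
     F i (T i j) = F j (T i j) &
     forall u, u \in `[0, 1] -> u < T i j -> F i u < F j u]) ->
  (forall i j l, (i < j < l)%N -> (l <= n.*2)%N -> F j (T i l) < F i (T i l)) ->
  (forall i j l, (i < j < l)%N -> (l <= n.*2)%N ->
     if c then F i (T j l) < F j (T j l) else F j (T j l) < F i (T j l)) ->
  forall i, (i < n)%N -> exists2 t, t \in `[0, 1] & forall j, (j < n)%N -> j != i ->
    if c then F j.*2 t < F i.*2 t else F i.*2 t < F j.*2 t.
Proof.
move=> HT below side i lt_in.
case: c side => side.
- have [|T01 _ _] := HT i.*2 n.*2; first by lia.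
  exists (T i.*2 n.*2) => // j lt_jn; rewrite neq_ltn => /orP[ji|ij].
    by apply: side; lia.
  by apply: below; lia.
have [|T01 eqT _] := HT i.*2 i.*2.+1; first by lia.
exists (T i.*2 i.*2.+1) => // j lt_jn; rewrite neq_ltn => /orP[ji|ij].
  by apply: side; lia.
(* A later path [j.*2] is still above if it first meets [i.*2] after [T i.*2 i.*2.+1]; otherwise
   [i.*2.+1] would not be below [i.*2] at [T i.*2 j.*2]. *)
have [|T01' _ before] := HT i.*2 j.*2; first by lia.
apply: before => //; rewrite ltNge le_eqVlt; apply/negP.
have := below i.*2 i.*2.+1 j.*2 ltac:(lia) ltac:(lia).
move=> lt_F /orP[/eqP e|lt_T]; first by move: lt_F; rewrite e eqT ltxx.
have [|_ _ before'] := HT i.*2 i.*2.+1; first by lia.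
by have := lt_trans lt_F (before' _ T01' lt_T); rewrite ltxx.
Qed.

(** Passes from paths numbered by naturals to a subset of the index type; [c] tells upper from
    lower. *)
Lemma envelope_imset (R : realType) (I : finType) (f : I -> R -> R) (n : nat)
    (e : nat -> I) (c : bool) :
  (forall i j, (i < n)%N -> (j < n)%N -> e i = e j -> i = j) ->
  (forall i, (i < n)%N -> exists2 t, t \in `[0, 1] &
     forall j, (j < n)%N -> j != i ->
       if c then f (e j) t < f (e i) t else f (e i) t < f (e j) t) ->
  exists A : {set I}, #|A| = n /\
    (upper_convex (@subsystem R I f A) \/ lower_convex (@subsystem R I f A)).
Proof.
move=> inj_e He; exists [set e (val i) | i : 'I_n]; split.
  rewrite card_imset ?card_ord // => i j /inj_e eij; apply: val_inj.
  by apply: eij; exact: ltn_ord.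
have neq (i j : 'I_n) : e j != e i -> j != i :> nat.
  by apply: contraNN => /eqP ->.
case: c He => He; [left|right] => -[a a_in];
  have /imsetP[i _ ea] := a_in; have [t t01 Ht] := He i (ltn_ord i);
  exists t => // -[b b_in] ba; have /imsetP[j _ eb] := b_in;
  rewrite /subsystem /= ea eb;
  apply: (Ht _ (ltn_ord j)); apply: neq; apply: contraNN ba => /eqP eij;
  by rewrite -val_eqE /= ea eb eij.
Qed.

Lemma crossing_system_bound (R : realType) (k n : nat) :
  exists2 C, (0 < C)%N & convex_subsystem_bound R k n C.
Proof.
have [M HM] := ramsey 3 (fun _ : bool * bool * bool => n.*2.+1).
exists M.+1 => // I f [sysf crossf] MI.
have pathf := system_path sysf.
pose lt0 : rel I := fun i j => f i 0 < f j 0.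
have irr0 : irreflexive lt0 by move=> i; rewrite /lt0 ltxx.
have tr0 : transitive lt0 by move=> j i l; exact: lt_trans.
have ne0 i j : lt0 i j -> i != j by apply: contraTneq => ->; rewrite irr0.
have /choice[T2 HT2] : forall ij : I * I, exists t, lt0 ij.1 ij.2 ->
    [/\ t \in `[0, 1], f ij.1 t = f ij.2 t &
      forall u, u \in `[0, 1] -> u < t -> f ij.1 u < f ij.2 u].
  (* Pairs not increasing at 0 get the dummy time 0. *)
  move=> [i j] /=; case: (boolP (lt0 i j)) => [ij|_]; last by exists 0.
  have [|t Ht] := first_meeting (pathf i) (pathf j) ij
    (system_finite_intersections sysf (ne0 _ _ ij)); last by exists t.
  have [[t [t01 ft _]] _] := crossf i j (ne0 _ _ ij).
  exists t; split => //; move: t01; rewrite !in_itv /= => /andP[t0 t1].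
  by rewrite !ltW.
pose T i j := T2 (i, j).
have {}HT2 i j (ij : lt0 i j) :
    [/\ T i j \in `[0, 1], f i (T i j) = f j (T i j) &
    forall u, u \in `[0, 1] -> u < T i j -> f i u < f j u] := HT2 (i, j) ij.
(* A third path is strictly on one side of a meeting, so a false bit of [chi] will give the reverse
   strict inequality. *)
have apart i j l t : i != j -> j != l -> i != l -> t \in `[0, 1] ->
    f i t = f j t -> f l t != f j t.
  move=> ij jl il t01 e; apply/eqP => e'.
  exact: (system_no_triple_point sysf ij jl il t01 (conj e (esym e'))).
pose S := sort (relpre (f^~ 0) <=%R) (enum I).
have sorted_S : sorted lt0 S.
  rewrite (_ : lt0 = relpre (f^~ 0) <%R) // -sorted_map lt_sorted_uniq_le.
  rewrite map_inj_uniq ?sort_uniq ?enum_uniq /=; last first.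
    move=> i j; apply: contra_eq => ij.
    exact: system_left_endpoints sysf _ _ ij.
  by rewrite sorted_map; apply: sort_sorted => i j; exact: le_total.
(* Two of the three paths agree at each of these times, so comparing the third with one of them is
   enough. *)
pose chi (s : seq I) := if s is [:: i; j; l] then
  (f j (T i l) < f i (T i l), f i (T j l) < f j (T j l),
   f j (T i j) < f l (T i j))
  else (true, true, true).
have [|[[c d] e] [s [sub_s size_s hom]]] := HM I chi S.
  by rewrite size_sort -cardE ltnW.
have sorted_s : sorted lt0 s := subseq_sorted tr0 sub_s sorted_S.
have [i0 _] : exists i, i \in s.
  by case: s size_s {sub_s hom sorted_s} => // i *; exists i; rewrite mem_head.
pose h := nth i0 s.
have lt_h i j : (i < j <= n.*2)%N -> lt0 (h i) (h j).
  by move=> ij; apply: (sorted_ltn_nth tr0) => //; rewrite ?inE ?size_s; lia.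
have chi_h i j l : (i < j < l)%N -> (l <= n.*2)%N ->
    chi [:: h i; h j; h l] = (c, d, e).
  move=> ijl ln; apply: hom => //.
  apply: (sorted_subset_subseq irr0 tr0 sorted_s).
    by rewrite /= !lt_h //; lia.
  by move=> x; rewrite !inE => /or3P[] /eqP ->; apply: mem_nth; rewrite size_s; lia.
have inj_h i j : (i <= n.*2)%N -> (j <= n.*2)%N -> h i = h j -> i = j.
  move=> ilt jlt hij; case: (ltngtP i j) => // lt.
    by have := lt_h i j; rewrite lt jlt hij irr0 => /(_ isT).
  by have := lt_h j i; rewrite lt ilt hij irr0 => /(_ isT).
have meet_h i j (ij : (i < j <= n.*2)%N) := HT2 _ _ (lt_h i j ij).
have apart_h i j l : (i < j <= n.*2)%N -> (l <= n.*2)%N -> l != i -> l != j ->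
    f (h l) (T (h i) (h j)) != f (h j) (T (h i) (h j)).
  move=> ij ln li lj; have [T01 eqT _] := meet_h _ _ ij.
  have neq_h u v : (u <= n.*2)%N -> (v <= n.*2)%N -> u != v -> h u != h v.
    by move=> un vn; apply: contra_neq => /inj_h ->.
  by apply: apart eqT => //; apply: neq_h => //; lia.
have flip (x y : R) : x != y -> (x < y) = false -> y < x.
  by rewrite [y < x]lt_neqAle eq_sym => -> /negbT; rewrite -leNgt.
case: c chi_h {hom} => chi_h.
- apply: (@envelope_imset _ _ _ _ (fun i => h i.*2) d).
    by move=> i j ilt jlt /inj_h; lia.
  apply: (@homogeneous_envelope _ _ (fun i => f (h i))
    (fun i j => T (h i) (h j))).
  + by move=> i j ij; apply: HT2; exact: lt_h.
  + by move=> i j l ijl ln; case: (chi_h i j l ijl ln).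
  + move=> i j l ijl ln; have [_ + _] := chi_h i j l ijl ln.
    have [|_ -> _] := meet_h j l; first by lia.
    by case: d {chi_h} => //; apply: flip; apply: apart_h; lia.
(* Reflection exchanges top and bottom, hence [~~ e]; position [i.*2] is now counted from the other
   end. *)
apply: (@envelope_imset _ _ _ _ (fun i => h (n.*2 - i.*2)%N) (~~ e)).
  by move=> i j ilt jlt /inj_h; lia.
move=> i lt_in.
(* Reflecting the paths and reversing their order reduces to the previous case. *)
have [|||t t01 Ht] := @homogeneous_envelope _ n
  (fun i u => - f (h (n.*2 - i)%N) u)
  (fun i j => T (h (n.*2 - j)%N) (h (n.*2 - i)%N)) e _ _ _ i lt_in.
- move=> a b ab; have [|T01 eqT before] := meet_h (n.*2 - b)%N (n.*2 - a)%N.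
    by lia.
  split => //; first by rewrite eqT.
  by move=> u u01 lt_u; rewrite ltrN2; exact: before.
- move=> a b g abg gn.
  have [+ _ _] := chi_h (n.*2 - g)%N (n.*2 - b)%N (n.*2 - a)%N
    ltac:(lia) ltac:(lia).
  have [|_ -> _] := meet_h (n.*2 - g)%N (n.*2 - a)%N; first by lia.
  by rewrite ltrN2; apply: flip; apply: apart_h; lia.
(* Reversal turns the meeting of [b] and [g] into that of the first two of the three original
   positions, so the third bit takes the role of the second. *)
- move=> a b g abg gn.
  have [_ _ +] := chi_h (n.*2 - g)%N (n.*2 - b)%N (n.*2 - a)%N
    ltac:(lia) ltac:(lia).
  rewrite !ltrN2; case: e {chi_h} => //; apply: flip.
  by rewrite eq_sym; apply: apart_h; lia.
exists t => // j lt_jn ji; have := Ht j lt_jn ji.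
by rewrite !ltrN2; case: e {Ht chi_h}.
Qed.

Theorem theorem1p4 (R : realType) (k n : nat) (hk : (1 <= k)%N) (hn : (3 <= n)%N) :
  exists C : nat,
    [/\ (0 < C)%N,
        convex_subsystem_bound R k n C &
        forall C' : nat, (0 < C')%N -> convex_subsystem_bound R k n C' ->
          (C <= C')%N].
Proof.
pose P C := (0 < C)%N && `[< convex_subsystem_bound R k n C >].
have exP : exists C, P C.
  have [C C0 HC] := crossing_system_bound R k n.
  by exists C; apply/andP; split => //; exact/asboolP.
case: (ex_minnP exP) => C /andP[C0 /asboolP HC] minC.
exists C; split => // C' C'0 HC'; apply: minC.
by apply/andP; split => //; exact/asboolP.
Qed.
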